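(* Let $F$ be a $4$-regular graph, let $P$ be a circuit partition of $F$, and let $E\subseteq E(F)$ be such that each circuit of $P$ traverses at most one edge of $E$. If $\Gamma$ is a cycle spanning set of $F-E$, then $\pi_P(\Gamma\setminus P)$ is a cycle spanning set of $\mathrm{Tch}(P)$. If moreover $\Gamma$ is integral, then $\pi_P(\Gamma\setminus P)$ is an integral cycle spanning set of $\mathrm{Tch}(P)$.
   Context: Graphs: $G=(V,H,E,\epsilon)$ with finite sets of vertices $V$ and half-edges $H$, a partition $E$ of $H$ into unordered pairs (edges), and $\epsilon:H\to V$; loops and multiple edges allowed. For $E'\subseteq E(G)$, $G-E'$ is obtained by deleting the edges of $E'$. A directed version orders each edge as (tail, head). A single transition is an unordered pair of distinct half-edges incident with a common vertex; a directed single transition is such an ordered pair. A closed walk is a sequence $((h_1,h_2),\dots,(h_{n-1},h_n))$ of directed single transitions with $\{h_2,h_3\},\{h_4,h_5\},\dots,\{h_n,h_1\}$ edges, up to cyclic shift. For a directed version $D$ and closed walk $W$, $\sigma(D,W)\in\mathbb Z^{E}$ counts, at each edge $e$, traversals of $e$ along its direction minus traversals against it. A circuit is a nonempty closed walk using each half-edge at most once, with orientation forgotten. The cycle space of $D$ is the right null space over $\mathbb Q$ of its vertex-edge incidence matrix (entry $1$ if $v$ is incident to the tail but not head of $e$, $-1$ if to the head but not tail, $0$ otherwise). A cycle basis of $G$ is a set $B$ of closed walks such that the vectors $\sigma(D,W)$, $W\in B$, are pairwise distinct and form a basis of the cycle space of $D$. A cycle spanning set is a set of closed walks containing a cycle basis.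 A cycle spanning set $B$ is integral if $\sigma(D,W)$ lies in the $\mathbb Z$-span of $\{\sigma(D,W'):W'\in B\}$ for every closed walk $W$ of $G$. $F$ is $4$-regular if every vertex is incident with exactly $4$ half-edges. A transition at $v$ is a partition of the four half-edges at $v$ into two single transitions. A circuit partition $P$ is a set of circuits of $F$ such that every half-edge lies in exactly one single transition of exactly one circuit of $P$; $\tau(P)$ is the set of transitions both of whose single transitions occur in circuits of $P$. The touch-graph $\mathrm{Tch}(P)$ has vertex set $P$, half-edge set the set of single transitions occurring in circuits of $P$, edge set $\tau(P)$, and maps each single transition to the circuit containing it. For a closed walk $W$ of $F$, $\pi_P(W)$ is obtained by replacing each directed single transition $(h,h')$ of $W$ by $(s,s')$, where $s,s'$ are the single transitions of circuits of $P$ containing $h,h'$ respectively, and deleting the pairs with $s=s'$; it is a closed walk of $\mathrm{Tch}(P)$ in which each remaining pair $(s,s')$ traverses the edge $\{s,s'\}$ from half-edge $s$ to half-edge $s'$. For a set $S$ of closed walks, $\pi_P(S)$ is the multiset $\{\pi_P(W):W\in S\}$; $\Gamma\setminus P$ denotes $\Gamma$ with (any orientations of) circuits of $P$ removed.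
   Formalization: Each π_P(W) is treated as a sequence of edge traversals with its σ-vector; it is not asserted to be a closed walk of Tch(P), since it may backtrack along an edge, which the definition of closed walk by single transitions of distinct half-edges forbids. *)

(* Defs.v *)
From HB Require Import structures.
From mathcomp Require Import all_boot all_order all_algebra.
Set Implicit Arguments. Unset Strict Implicit. Unset Printing Implicit Defensive.
Import Order.TTheory GRing.Theory Num.Theory.
Local Open Scope ring_scope.

(* Graphs with half-edges.  The partition of H into edges is encoded by  *)
(* the "mate" map h |-> other half-edge of the edge of h; the graph      *)
(* axioms (mate is a fixed-point-free involution) are the predicate      *)
(* is_graph, so that derived constructions (F - E, Tch(P)) are plain     *)
(* data.                                                                 *)
Record graph := Graph {
  gV : finType;
  gH : finType;
  gmate : gH -> gH;
  gend : gH -> gV }.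
Arguments gmate : clear implicits.
Arguments gend : clear implicits.

Definition is_graph (G : graph) : Prop :=
  involutive (gmate G) /\ forall h, gmate G h != h.

Definition four_regular (G : graph) : Prop :=
  forall v : gV G, #|[set h : gH G | gend G h == v]| = 4%N.

Definition edge_of (G : graph) (h : gH G) : {set gH G} := [set h; gmate G h].

(* A set E of edges, encoded as the set of their half-edges. *)
Definition edge_set (G : graph) (X : {set gH G}) : Prop :=
  forall h, (gmate G h \in X) = (h \in X).

Definition delete_edges (G : graph) (X : {set gH G}) : graph :=
  @Graph (gV G) {h : gH G | h \notin X}
    (fun h => insubd h (gmate G (val h)))
    (fun h => gend G (val h)).
Arguments delete_edges : clear implicits.

(* Walks.  A directed single transition is a pair (h, h').  A closed    *)
(* walk is a sequence ((h1,h2),...,(h_{n-1},h_n)) of directed single    *)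
(* transitions with {h2,h3},...,{hn,h1} edges.                          *)
Definition dst (G : graph) (p : gH G * gH G) : bool :=
  (p.1 != p.2) && (gend G p.1 == gend G p.2).

Definition traversals (G : graph) (W : seq (gH G * gH G)) : seq (gH G * gH G) :=
  zip (map snd W) (rot 1 (map fst W)).

Definition closed_walk (G : graph) (W : seq (gH G * gH G)) : bool :=
  all (@dst G) W && all (fun t => gmate G t.1 == t.2) (traversals W).

Definition halfedges (G : graph) (W : seq (gH G * gH G)) : seq (gH G) :=
  flatten (map (fun p => [:: p.1; p.2]) W).

Definition circuit (G : graph) (C : seq (gH G * gH G)) : bool :=
  [&& closed_walk C, C != [::] & uniq (halfedges C)].

(* reversal and cyclic shifts: a circuit is a closed walk up to these *)
Definition rev_walk (G : graph) (W : seq (gH G * gH G)) : seq (gH G * gH G) :=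
  rev (map (fun p => (p.2, p.1)) W).

Definition same_circuit (G : graph) (W C : seq (gH G * gH G)) : bool :=
  has (fun k => (W == rot k C) || (W == rot k (rev_walk C))) (iota 0 (size C)).

(* Directed versions, sigma, cycle space.                               *)
(* A directed version is given by dir : H -> bool, dir h = true meaning *)
(* h is the tail of its edge.  The edges of the directed version are    *)
(* indexed by their tail half-edges.                                    *)
Definition orientation (G : graph) (dir : gH G -> bool) : Prop :=
  forall h, dir (gmate G h) = ~~ dir h.

Definition dedge (G : graph) (dir : gH G -> bool) : finType :=
  {h : gH G | dir h}.

Definition sigma_tr (G : graph) (dir : gH G -> bool) (T : seq (gH G * gH G))
  : {ffun dedge dir -> int} :=
  [ffun e : dedge dir =>
     (count (pred1 (val e, gmate G (val e))) T)%:Z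
     - (count (pred1 (gmate G (val e), val e)) T)%:Z].

Definition sigma (G : graph) (dir : gH G -> bool) (W : seq (gH G * gH G)) :=
  sigma_tr dir (traversals W).

Definition incidence (G : graph) (dir : gH G -> bool) (v : gV G) (e : dedge dir)
  : rat :=
  let t := val e in
  if (gend G t == v) && (gend G (gmate G t) != v) then 1
  else if (gend G (gmate G t) == v) && (gend G t != v) then -1 else 0.

Definition in_cycle_space (G : graph) (dir : gH G -> bool) (x : dedge dir -> rat)
  : Prop :=
  forall v : gV G, \sum_(e : dedge dir) incidence v e * x e = 0.

Definition cycle_space_basis (G : graph) (dir : gH G -> bool)
  (xs : seq {ffun dedge dir -> int}) : Prop :=
  [/\ forall x, x \in xs -> in_cycle_space (fun e => (x e)%:~R),
      forall c : 'I_(size xs) -> rat,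
        (forall e, \sum_(i < size xs) c i * ((nth 0 xs i) e)%:~R = 0) ->
        forall i, c i = 0 &
      forall x : dedge dir -> rat, in_cycle_space x ->
        exists c : 'I_(size xs) -> rat,
          forall e, x e = \sum_(i < size xs) c i * ((nth 0 xs i) e)%:~R].

Definition tr_spanning (G : graph) (T : seq (seq (gH G * gH G))) : Prop :=
  exists B : seq (seq (gH G * gH G)), {subset B <= T} /\
    forall dir, orientation dir ->
      uniq (map (sigma_tr dir) B) /\ cycle_space_basis (map (sigma_tr dir) B).

Definition tr_integral (G : graph) (T : seq (seq (gH G * gH G))) : Prop :=
  forall W, closed_walk W -> forall dir, orientation dir ->
    exists c : 'I_(size T) -> int,
      forall e, sigma dir W e = \sum_(i < size T) c i * (sigma_tr dir (nth [::] T i)) e.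

Definition cycle_spanning_set (G : graph) (Gam : seq (seq (gH G * gH G))) : Prop :=
  all (@closed_walk G) Gam /\ tr_spanning (map (@traversals G) Gam).

Definition integral_cycle_spanning_set (G : graph) (Gam : seq (seq (gH G * gH G)))
  : Prop :=
  cycle_spanning_set Gam /\ tr_integral (map (@traversals G) Gam).

Definition circuit_partition (F : graph) (P : seq (seq (gH F * gH F))) : Prop :=
  all (@circuit F) P /\
  forall h : gH F, count_mem h (flatten (map (@halfedges F) P)) = 1%N.

Section Touch.
Variables (F : graph) (P : seq (seq (gH F * gH F))).

Definition st_set (C : seq (gH F * gH F)) : {set {set gH F}} :=
  [set [set p.1; p.2] | p in C].

Definition STP : {set {set gH F}} := [set s | has (fun C => s \in st_set C) P].

Definition tch_H : finType := {s : {set gH F} | s \in STP}.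

Lemma tch_end_lt (s : tch_H) : (find (fun C => val s \in st_set C) P < size P)%N.
Proof. by rewrite -has_find; have := valP s; rewrite inE. Qed.

Definition tch_end (s : tch_H) : 'I_(size P) := Ordinal (tch_end_lt s).

(* the other single transition at the same vertex *)
Definition tch_mate (s : tch_H) : tch_H :=
  insubd s ([set h | gend F h \in gend F @: val s] :\: val s).

Definition Tch : graph := @Graph 'I_(size P) tch_H tch_mate tch_end.

Definition st_of (h : gH F) : {set gH F} := odflt set0 [pick s in STP | h \in s].

Definition pi_pair (p : gH F * gH F) : option (tch_H * tch_H) :=
  match insub (st_of p.1), insub (st_of p.2) with
  | Some a, Some b => if a != b then Some (a, b) else None
  | _, _ => None
  end.

Definition pi_P (W : seq (gH F * gH F)) : seq (gH Tch * gH Tch) := pmap pi_pair W.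

Definition minus_P (Gam : seq (seq (gH F * gH F))) : seq (seq (gH F * gH F)) :=
  filter (fun W => ~~ has (fun C => same_circuit W C) P) Gam.

Definition traversed_in (C : seq (gH F * gH F)) (X : {set gH F}) : nat :=
  #|[set e in [set [set t.1; t.2] | t in traversals C] | e \subset X]|.

End Touch.

Definition lift_walk (F : graph) (X : {set gH F})
  (W : seq (gH (delete_edges F X) * gH (delete_edges F X))) : seq (gH F * gH F) :=
  map (fun p => (val p.1, val p.2)) W.

(* Main.v *)
Require Import Defs.
From HB Require Import structures.
From mathcomp Require Import all_boot all_order all_algebra.
From mathcomp Require Import zify ring.
Set Implicit Arguments. Unset Strict Implicit. Unset Printing Implicit Defensive.
Import Order.TTheory GRing.Theory Num.Theory.
Local Open Scope ring_scope.

(** A cycle is a flow: an alternating function g on half-edges whose sum at every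
    vertex is zero; this description does not depend on an orientation.  On flows
    pi_P is the linear map sending g to (s |-> - sum of g over the half-edges of
    s).  It maps the flows of F - E onto those of Tch(P), over any commutative
    ring: a flow y of Tch(P) sums to zero around each circuit of P, so its prefix
    sums along the circuit lift it, uniquely up to a constant on each circuit, and
    that constant can be chosen so that the lift vanishes on the single edge of E
    that the circuit may traverse.  Hence pi_P maps a spanning set to a spanning
    set, and the circuits of P are mapped to zero.  Over the integers, a flow is a
    sum of flows of closed walks, so an integral spanning set spans all integral
    flows. *)

(** * Flows and spanning sets *)

Definition alternating (R : comNzRingType) (G : graph) (g : gH G -> R) : Prop :=
  forall h, g (gmate G h) = - g h.

Definition flow (R : comNzRingType) (G : graph) (g : gH G -> R) : Prop :=
  alternating g /\ forall v, \sum_(h | gend G h == v) g h = 0.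

(** [sigma_tr] without a directed version: at the tail of an edge it is the entry of [sigma_tr], at
    the head its negative. *)
Definition net (G : graph) (T : seq (gH G * gH G)) (h : gH G) : int :=
  (count (pred1 (h, gmate G h)) T)%:Z - (count (pred1 (gmate G h, h)) T)%:Z.

Definition spanned (R : comNzRingType) (G : graph) (Ts : seq (seq (gH G * gH G)))
  (g : gH G -> R) : Prop :=
  exists c : 'I_(size Ts) -> R,
    forall h, g h = \sum_(i < size Ts) c i * (net (nth [::] Ts i) h)%:~R.

Section Spanned.
Variables (R : comNzRingType) (G : graph).
Implicit Types (Ts : seq (seq (gH G * gH G))) (g : gH G -> R).

Lemma spanned_sum Ts (I : Type) (r : seq I) (a : I -> R) (g : I -> gH G -> R)
    (f : gH G -> R) :
  (forall h, f h = \sum_(i <- r) a i * g i h) ->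
  (forall i, spanned Ts (g i)) -> spanned Ts f.
Proof.
move=> Ef gP; elim: r f Ef => [|i r IHr] f Ef.
  exists (fun=> 0) => h; rewrite Ef big_nil big1 // => i _; exact: mul0r.
have [c Ec] := IHr (fun h => \sum_(j <- r) a j * g j h) (fun=> erefl).
have [d Ed] := gP i.
exists (fun k => a i * d k + c k) => h.
rewrite Ef big_cons Ec Ed mulr_sumr -big_split /=.
by apply: eq_bigr => k _; rewrite mulrDl mulrA.
Qed.

Lemma spanned_net Ts T : T \in Ts -> spanned Ts (fun h => (net T h)%:~R : R).
Proof.
move=> TTs; have ltT : (index T Ts < size Ts)%N by rewrite index_mem.
exists (fun i => (i == Ordinal ltT)%:R) => h.
rewrite (bigD1 (Ordinal ltT)) //= eqxx mul1r nth_index // big1 ?addr0 //.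
by move=> i /negPf->; rewrite mul0r.
Qed.

End Spanned.

Section GraphFlows.
Variable G : graph.
Hypothesis GP : is_graph G.
Let mateK : involutive (gmate G). Proof. by case: GP. Qed.
Let mate_neq h : gmate G h != h. Proof. by case: GP => _ /(_ h). Qed.

Lemma net_alternating T : alternating (@net G T).
Proof. by move=> h; rewrite /net mateK opprB. Qed.

Lemma orientation_exists : exists dir : gH G -> bool, orientation dir.
Proof.
exists (fun h => enum_rank h < enum_rank (gmate G h))%N => h /=.
rewrite mateK ltn_neqAle -leqNgt andb_idl // => _.
by apply: contraNneq (mate_neq h) => /val_inj/enum_rank_inj->.
Qed.

(** The terms of the heads are reindexed by their tails, and alternation gives the minus sign. At a
    loop the two indicators cancel, as in [incidence]. *)
Lemma incidence_sum (R : comNzRingType) (dir : gH G -> bool) (g : gH G -> R) v :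
  orientation dir -> alternating g ->
  \sum_(h | gend G h == v) g h =
  \sum_(e : dedge dir) ((gend G (val e) == v)%:R
                        - (gend G (gmate G (val e)) == v)%:R) * g (val e).
Proof.
move=> dirP gA.
rewrite big_mkcond (bigID dir) /= [X in _ + X](reindex_inj (inv_inj mateK)) /=.
rewrite [X in _ + X](eq_bigl dir) => [|h]; last by rewrite dirP negbK.
rewrite -big_split /= (big_sub dir (fun h => _ + _)).
apply: eq_bigr => e _; rewrite gA mulrBl.
by do 2 case: (_ == v); rewrite ?mul1r ?mul0r ?subr0 ?sub0r ?addr0 ?add0r.
Qed.

Lemma in_cycle_spaceE (dir : gH G -> bool) (g : gH G -> rat) :
  orientation dir -> alternating g ->
  in_cycle_space (fun e : dedge dir => g (val e)) <->
  forall v, \sum_(h | gend G h == v) g h = 0.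
Proof.
move=> dirP gA.
suff E v : \sum_(e : dedge dir) incidence v e * g (val e)
    = \sum_(h | gend G h == v) g h.
  by split=> g0 v; [rewrite -E g0 | rewrite E g0].
rewrite (incidence_sum v dirP gA); apply: eq_bigr => e _; rewrite /incidence.
by do 2 case: (_ == v).
Qed.

Lemma alternating_eq (R : comNzRingType) (dir : gH G -> bool) (f g : gH G -> R) :
  orientation dir -> alternating f -> alternating g ->
  (forall e : dedge dir, f (val e) = g (val e)) -> f =1 g.
Proof.
move=> dirP fA gA E h; case dh: (dir h); first exact: (E (exist (fun x => dir x) h dh)).
have dmh : dir (gmate G h) by rewrite dirP dh.
by apply: oppr_inj; rewrite -fA -gA (E (exist (fun x => dir x) _ dmh)).
Qed.

Lemma sum_alternating (R : comNzRingType) I (r : seq I) (c : I -> R) 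
    (g : I -> gH G -> R) :
  (forall i, alternating (g i)) -> alternating (fun h => \sum_(i <- r) c i * g i h).
Proof.
move=> gA h; rewrite -sumrN; apply: eq_bigr => i _.
by rewrite gA mulrN.
Qed.

Lemma net_alternatingR (R : comNzRingType) T :
  alternating (fun h => (@net G T h)%:~R : R).
Proof. by move=> h; rewrite net_alternating mulrNz. Qed.

(** One directed version suffices: coefficients that match on tails match on all half-edges, both
    sides being alternating. *)
Lemma tr_spanning_flow Ts (g : gH G -> rat) :
  tr_spanning Ts -> flow g -> spanned Ts g.
Proof.
move=> [B [sBT BP]] [gA g0]; have [dir dirP] := orientation_exists.
have [_ [_ _ spanB]] := BP _ dirP.
have [|c] := spanB (fun e => g (val e)); first by apply/(in_cycle_spaceE dirP).
move: c; rewrite size_map => c Ec.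
apply: (@spanned_sum _ _ _ _ (enum 'I_(size B)) c
  (fun i h => (net (nth [::] B i) h)%:~R)); last first.
  by move=> i; apply/spanned_net/sBT/mem_nth.
apply: (alternating_eq dirP) => // [|e].
  by apply: sum_alternating => i; apply: net_alternatingR.
rewrite Ec big_enum /=; apply: eq_bigr => i _.
by rewrite (nth_map [::]) // ffunE.
Qed.

(** Values in [rat^o] make these functions vectors, to which [free] and spans apply. *)
Let netv (T : seq (gH G * gH G)) : {ffun gH G -> rat^o} :=
  [ffun h => (net T h)%:~R].

(** Greedy choice: an index is kept only if its vector lies outside the span of those already kept.
    The result lists indices, so that a basis will consist of members of [Ts]. *)
Lemma free_subfamily (K : fieldType) (V : vectType K) (I : eqType) (f : I -> V)
    (s : seq I) :
  exists2 t : seq I, {subset t <= s} & free (map f t) && (<<map f s>> <= <<map f t>>)%VS.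
Proof.
elim: s => [|x s [t sts /andP[tF st]]].
  by exists [::] => //; rewrite /free span_nil dimv0 eqxx subvv.
have [xt|xt] := boolP (f x \in <<map f t>>%VS).
  exists t => [y /sts|]; first by rewrite inE orbC => ->.
  by rewrite tF span_cons subv_add st -memvE xt.
exists (x :: t) => [y|]; first by rewrite !inE => /orP[->//|/sts->]; rewrite orbT.
by rewrite /= free_cons xt tF !span_cons addvS.
Qed.

Lemma uniq_map_refine (I A B : eqType) (f : I -> A) (g : I -> B) (s : seq I) :
  (forall x y, g x = g y -> f x = f y) -> uniq (map f s) -> uniq (map g s).
Proof.
move=> fg; elim: s => //= x s IHs /andP[fx /IHs->]; rewrite andbT.
by apply: contra fx => /mapP[y ys /fg->]; apply: map_f.
Qed.

Lemma alternating_extension (R : comNzRingType) dir (x : dedge dir -> R) :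
  orientation dir ->
  exists2 g : gH G -> R, alternating g & forall e, g (val e) = x e.
Proof.
move=> dirP; pose y h := oapp x 0 (insub h).
exists (fun h => y h - y (gmate G h)) => [h|e]; first by rewrite mateK opprB.
by rewrite /y valK /= insubN ?subr0 // dirP negbK (valP e).
Qed.

(** [tr_spanning] asks for one subfamily that is a basis for every directed version. A free
    subfamily of the [net] vectors with the same span serves, since these vectors do not depend on
    the direction. *)
Lemma flow_tr_spanning (Ts : seq (seq (gH G * gH G))) :
  (forall T, T \in Ts -> flow (net T)) ->
  (forall g : gH G -> rat, flow g -> spanned Ts g) -> tr_spanning Ts.
Proof.
move=> TsF Tsspan.
have [B sBT /andP[Bfree spanB]] := free_subfamily netv Ts.
exists B; split=> // dir dirP.
have netE (c : 'I_(size B) -> rat) (g : gH G -> rat) : alternating g ->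
    (forall e : dedge dir, g (val e) =
      \sum_(i < size B) c i * (net (nth [::] B i) (val e))%:~R) ->
    g =1 fun h => \sum_(i < size B) c i * (net (nth [::] B i) h)%:~R.
  move=> gA; apply: (alternating_eq dirP gA).
  by apply: sum_alternating => i; apply: net_alternatingR.
have sizeB : size (map netv B) == size B by rewrite size_map.
have nthB i : (i < size B)%N ->
    (Tuple sizeB)`_i = [ffun h => (net (nth [::] B i) h)%:~R : rat^o].
  by move=> ltiB; rewrite /= (nth_map [::]).
split.
  (* A free family has no repetitions, and equal [sigma_tr] force equal [net]. *)
  apply: uniq_map_refine (free_uniq Bfree) => T T' /ffunP ETT'.
  apply/ffunP=> h; rewrite !ffunE; congr _%:~R.
  apply: (alternating_eq dirP) h; try exact: net_alternating.
  by move=> e; have:= ETT' e; rewrite !ffunE.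
split.
- move=> x /mapP[T /sBT/TsF[TA T0] ->] v.
  have [_ TZ] := in_cycle_spaceE dirP (@net_alternatingR rat T).
  rewrite -[RHS](TZ _ v) => [|u]; last by rewrite -rmorph_sum /= T0.
  by apply: eq_bigr => e _; rewrite ffunE.
- rewrite size_map => c c0.
  have freeB : free (Tuple sizeB) by [].
  move/freeP: freeB; apply.
  (* A relation that holds on the tails holds on all half-edges, by [netE]. *)
  apply/ffunP=> h; rewrite sum_ffunE !ffunE.
  rewrite (eq_bigr (fun i => c i * (net (nth [::] B i) h)%:~R)); last first.
    by move=> i _; rewrite nthB // !ffunE.
  apply: esym; apply: (netE c (fun=> 0)) => [?|e]; first by rewrite oppr0.
  rewrite -[LHS](c0 e); apply: eq_bigr => i _.
  by rewrite (nth_map [::]) // ffunE.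
- rewrite size_map => x x0; have [g gA gx] := alternating_extension x dirP.
  have [|c Ec] := Tsspan g.
    split=> //; apply/(in_cycle_spaceE dirP gA) => v; rewrite -[RHS](x0 v).
    by apply: eq_bigr => e _; rewrite gx.
  have gB : [ffun h => g h : rat^o] \in <<Tuple sizeB>>%VS.
    have -> : [ffun h => g h : rat^o] = \sum_(i < size Ts) c i *: netv (nth [::] Ts i).
      apply/ffunP=> h; rewrite sum_ffunE ffunE Ec.
      by apply: eq_bigr => i _; rewrite !ffunE.
    apply: (subvP spanB); apply: memv_suml => i _; apply/memvZ/memv_span.
    by apply: map_f; apply: mem_nth.
  have /ffunP Eg := coord_span gB.
  exists (fun i => coord (Tuple sizeB) i [ffun h => g h : rat^o]) => e.
  have := Eg (val e); rewrite ffunE gx sum_ffunE => ->; apply: eq_bigr => i _.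
  by rewrite nthB // (nth_map [::]) // !ffunE.
Qed.
End GraphFlows.

(** * Integral flows and closed walks *)

Lemma sum_count_mem_int (T : finType) (a : pred T) (s : seq T) :
  \sum_(x | a x) (count_mem x s)%:Z = (count a s)%:Z.
Proof.
elim: s => [|y s IHs] /=; first by rewrite big1.
rewrite PoszD -IHs; under eq_bigr => x _ do rewrite PoszD.
rewrite big_split /=; congr (_ + _); case ay: (a y).
  rewrite (bigD1 y) //= eqxx big1 ?addr0 // => x /andP[_ /negPf].
  by rewrite eq_sym => ->.
by rewrite big1 // => x ax; case: eqP => // E; rewrite E ax in ay.
Qed.

Section GraphWalks.
Variable G : graph.
Hypothesis GP : is_graph G.
Let mateK : involutive (gmate G). Proof. by case: GP. Qed.

(** A traversal leads from the second component of a transition to its mate, the first component of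
    the next one. So second components count the traversals from [h], first components those into
    [h]. *)
Lemma net_closed_walk W (h : gH G) : closed_walk W ->
  net (traversals W) h
  = (count_mem h (map snd W))%:Z - (count_mem h (map fst W))%:Z.
Proof.
move=> /andP[_ /allP WT].
have sz : size (map snd W) = size (rot 1 (map fst W)).
  by rewrite size_rot !size_map.
congr (Posz _ - Posz _).
  rewrite -[map snd W in RHS](@unzip1_zip _ _ _ (rot 1 (map fst W))) ?sz //.
  rewrite count_map; apply: eq_in_count => -[a b] /WT /= /eqP <-.
  by rewrite xpair_eqE andb_idr // => /eqP->.
have /permP-> : perm_eq (map fst W) (rot 1 (map fst W)).
  by rewrite perm_sym perm_rot.
rewrite -[rot 1 _ in RHS](@unzip2_zip _ _ (map snd W)) ?sz //.
rewrite count_map; apply: eq_in_count => -[a b] /WT /= /eqP <-.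
by rewrite xpair_eqE (can2_eq mateK mateK) eq_sym [in RHS]eq_sym andbb.
Qed.

(** Both components of a transition end at the same vertex, so the two counts agree there. *)
Lemma closed_walk_flow W : @closed_walk G W -> flow (net (traversals W)).
Proof.
move=> WP; split; first exact: net_alternating.
move=> v; under eq_bigr => h _ do rewrite net_closed_walk //.
rewrite sumrB !sum_count_mem_int !count_map; apply/eqP.
rewrite subr_eq0 eqz_nat; apply/eqP/eq_in_count => p pW /=.
by have /andP[/allP/(_ _ pW)/andP[_ /eqP->]] := WP.
Qed.

Section Support.
Variables (g : gH G -> int) (gF : flow g).

(** Continues along positive flow from the vertex that [h] leads to; the default [h] is not taken
    when [0 < g h]. *)
Let next h :=
  odflt h [pick k | (gend G k == gend G (gmate G h)) && (0 < g k)].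

Let nextP h : 0 < g h -> (gend G (next h) == gend G (gmate G h)) && (0 < g (next h)).
Proof.
move=> gh; rewrite /next; case: pickP => //= np.
have [gA g0] := gF; have /eqP := g0 (gend G (gmate G h)).
(* If no value at this vertex were positive, all would vanish, as they sum to zero; but one of them
   is [- g h]. *)
rewrite -oppr_eq0 -sumrN psumr_eq0 => [/allP/(_ (gmate G h))|k vk].
  rewrite mem_index_enum eqxx /= gA opprK => /(_ isT)/eqP gh0.
  by rewrite gh0 in gh.
by rewrite oppr_ge0 leNgt; have := np k; rewrite vk /= => ->.
Qed.

(* Following edges of positive flow one eventually runs around a closed walk. *)
Lemma flow_closed_walk h0 : 0 < g h0 ->
  exists W o, [/\ closed_walk W, o != [::], forall h, h \in o -> 0 < g h &
    forall h, net (traversals W) h = (h \in o)%:Z - (gmate G h \in o)%:Z].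
Proof.
move=> g0; have [gA _] := gF.
(* The iterates of [next] from [h0] run into a cycle [o], and [y] lies on it. *)
have /trajectP[i lti Ei] := looping_order next h0.
pose y := iter i next h0; pose o := orbit next y.
have Ey : iter (order next y) next y = y.
  have oP := @orbitPcycle _ next y; apply/(oP 3 4); exists (order next h0 - i).-1%N.
  by rewrite prednK ?subn_gt0 // -iterD subnK // ltnW.
have iter_gt0 k : 0 < g (iter k next h0).
  by elim: k => //= k /nextP/andP[].
have o_gt0 h : h \in o -> 0 < g h.
  by rewrite -fconnect_orbit => /iter_findex <-; rewrite /y -iterD.
have Eo : map next o = rot 1 o.
  rewrite /o /orbit; case: order Ey => // n Ey.
  have -> z k : map next (traject next z k) = traject next (next z) k.
    by elim: k z => //= k IHk z; rewrite IHk.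
  by rewrite trajectSr -iterSr Ey /= rot1_cons.
(* The traversals of this walk are the pairs [(h, gmate G h)] for [h] in [o]. *)
pose W := [seq (gmate G h, next h) | h <- o].
have sndW : map snd W = rot 1 o by rewrite -map_comp -Eo.
have fstW : map fst W = map (gmate G) o by rewrite -map_comp.
have WP : closed_walk W.
  apply/andP; split; apply/allP.
    move=> _ /mapP[h /o_gt0 gh ->]; have /andP[/eqP vh gn] := nextP gh.
    rewrite /dst /= vh eqxx andbT; apply: contraTneq gn => <-.
    by rewrite gA oppr_gt0 -leNgt ltW.
  rewrite /traversals sndW fstW -map_rot => t.
  have -> s : zip s (map (gmate G) s) = map (fun h => (h, gmate G h)) s.
    by elim: s => //= a s ->.
  by case/mapP=> h _ ->.
exists W, o; split=> // [|h].
  by rewrite /o /orbit -orderSpred.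
rewrite net_closed_walk // sndW fstW !count_uniq_mem; last first.
- by rewrite rot_uniq orbit_uniq.
- by rewrite (map_inj_uniq (inv_inj mateK)) orbit_uniq.
by rewrite mem_rot -{2}[h]mateK (mem_map (inv_inj mateK)).
Qed.
End Support.

(** Induction on the sum of the absolute values of [g]: the flow of a closed walk along positive
    half-edges is spanned by hypothesis, and subtracting it lowers that sum. *)
Lemma int_flow_spanned Ts (g : gH G -> int) :
  tr_integral Ts -> flow g -> spanned Ts g.
Proof.
move=> TsI; have [dir dirP] := orientation_exists GP.
have [n] := ubnP (\sum_h `|g h|)%N; elim: n g => // n IHn g /ltnSE le_gn gF.
have [/forallP g_le0|] := boolP [forall h, g h <= 0].
  apply: (@spanned_sum _ _ _ void [::] (fun=> 0) (fun _ _ => 0)) => // h.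
  rewrite big_nil; apply/eqP; rewrite eq_le g_le0 -oppr_le0.
  by have [gA _] := gF; rewrite -gA g_le0.
rewrite negb_forall => /existsP[h0]; rewrite -ltNge => gh0.
have [W [o [WP o0 o_gt0 netW]]] := flow_closed_walk gF gh0.
pose w := net (traversals W).
have wF : flow w by apply: closed_walk_flow.
have [gA g0] := gF; have [wA w0] := wF.
have [c Ec] : spanned Ts w.
  have [c] := TsI W WP dir dirP; rewrite /sigma => Ec; exists c.
  apply: (alternating_eq dirP) => // [|e].
    by apply: sum_alternating => i; apply: net_alternatingR.
  have := Ec e; rewrite ffunE => E; rewrite [LHS]E; apply: eq_bigr => i _.
  by rewrite ffunE intz.
have [] := IHn (fun h => g h - w h).
- apply: leq_trans le_gn; case: o o0 o_gt0 netW => // a o _ o_gt0 netW.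
  (* The mate of a half-edge in [o] has negative flow, so it is not in [o]: on [o] the value of [w]
     is 1 and [g] is at least 1. On the mates both are negative, and elsewhere [w] is 0. *)
  have le h : (`|g h - w h| <= `|g h| - (h \in a :: o))%N.
    rewrite /w netW; case: (boolP (h \in _)) => [/o_gt0 gh|_];
      case: (boolP (gmate G h \in _)) => [/o_gt0|_]; rewrite ?gA; lia.
  rewrite (bigD1 a) //= [X in (_ < X)%N](bigD1 a) //=.
  rewrite -addSn leq_add //.
    by have := le a; have := o_gt0 a; rewrite mem_head => /(_ isT); lia.
  by apply: leq_sum => h _; apply: leq_trans (le h) (leq_subr _ _).
- split=> [h|v]; first by rewrite gA wA; lia.
  by rewrite sumrB g0 w0 subrr.
move=> d Ed; exists (fun i => d i + c i) => h.
rewrite -[g h](subrK (w h)) Ed Ec -big_split /=.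
by apply: eq_bigr => i _; rewrite mulrDl.
Qed.

Lemma flow_tr_integral Ts :
  (forall g : gH G -> int, flow g -> spanned Ts g) -> tr_integral Ts.
Proof.
move=> TsP W WP dir _; have [c Ec] := TsP _ (closed_walk_flow WP).
exists c => e; rewrite ffunE [LHS]Ec; apply: eq_bigr => i _.
by rewrite ffunE intz.
Qed.

End GraphWalks.

(** * The touch-graph *)

Lemma uniq_flatten_nth (T : eqType) (ss : seq (seq T)) (x : T) i j :
  uniq (flatten ss) -> x \in nth [::] ss i -> x \in nth [::] ss j -> i = j.
Proof.
have mem_fl k s : x \in nth [::] s k -> x \in flatten s.
  move=> xk; apply/flattenP; exists (nth [::] s k) => //; apply: mem_nth.
  by rewrite ltnNge; apply: contraTN xk => /(nth_default [::])->.
elim: ss i j => [|s ss IHss] [|i] [|j] //=; rewrite cat_uniq.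
- by case/and3P=> _ /hasPn ns _ xs /mem_fl/ns; rewrite /= xs.
- by case/and3P=> _ /hasPn ns _ /mem_fl/ns /= /negP.
- by case/and3P=> _ _ /IHss IH xi xj; rewrite (IH i j).
Qed.

Lemma mem_halfedges (G : graph) (C : seq (gH G * gH G)) h :
  reflect (exists2 p, p \in C & h \in [set p.1; p.2]) (h \in halfedges C).
Proof.
apply: (iffP flatten_mapP) => -[p pC ph]; exists p => //.
  by rewrite !inE in ph *.
by rewrite !inE in ph *.
Qed.

Lemma halfedges_flatten (G : graph) (Cs : seq (seq (gH G * gH G))) :
  halfedges (flatten Cs) = flatten (map (@halfedges G) Cs).
Proof.
elim: Cs => //= C Cs <-.
by rewrite /halfedges map_cat flatten_cat.
Qed.

Lemma uniq_halfedges (G : graph) (C : seq (gH G * gH G)) :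
  uniq (halfedges C) -> uniq C.
Proof.
elim: C => //= r C IHC /and3P[_ r2 /IHC->].
rewrite andbT; apply: contra r2 => rC; apply/mem_halfedges; exists r => //.
by rewrite !inE eqxx orbT.
Qed.

(** This makes the single transition containing a half-edge well defined. *)
Lemma uniq_halfedges_pair (G : graph) (C : seq (gH G * gH G)) h p q :
  uniq (halfedges C) -> p \in C -> q \in C ->
  h \in [set p.1; p.2] -> h \in [set q.1; q.2] -> p = q.
Proof.
elim: C => //= r C IHC /and3P[r1 r2 uC].
have rN s : s \in C -> h \in [set s.1; s.2] -> h \in [set r.1; r.2] -> False.
  move=> sC hs; have hC : h \in halfedges C by apply/mem_halfedges; exists s.
  rewrite !inE => /orP[]/eqP E; subst h; last by rewrite hC in r2.
  by rewrite inE negb_or hC andbF in r1.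
move=> /predU1P[->|pC] /predU1P[->|qC] //.
- by move=> hr hq; case: (rN _ qC hq hr).
- by move=> hp hr; case: (rN _ pC hp hr).
exact: IHC.
Qed.

Lemma closed_walk_next (G : graph) (C : seq (gH G * gH G)) d k :
  closed_walk C -> (k < size C)%N ->
  gmate G (nth d C k).2 = (nth d C (if k.+1 == size C then 0 else k.+1)%N).1.
Proof.
(* The default is swapped because a traversal starts at a second component and ends at a first
   one. *)
move=> /andP[_ /(all_nthP (d.2, d.1))/(_ k)].
case: C => // x s; rewrite /traversals map_cons rot1_cons.
rewrite size_zip size_rcons /= !size_map minnn => + ltk => /(_ ltk).
rewrite nth_zip /= ?size_rcons ?size_map //=.
rewrite -[nth d.2 _ k]/(nth d.2 (map snd (x :: s)) k) (nth_map d) // => /eqP->; rewrite nth_rcons size_map eqSS.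
move: ltk; rewrite ltnS leq_eqVlt => /predU1P[->|ltk]; first by rewrite ltnn eqxx.
by rewrite ltk (nth_map d) // (ltn_eqF ltk).
Qed.

Lemma closed_walk_next_mem (G : graph) (C : seq (gH G * gH G)) p :
  closed_walk C -> p \in C -> exists2 q, q \in C & gmate G p.2 = q.1.
Proof.
move=> CP pC; have ltp : (index p C < size C)%N by rewrite index_mem.
have := closed_walk_next p CP ltp; rewrite nth_index // => ->.
set k := (if _ then _ else _); exists (nth p C k) => //.
rewrite mem_nth // /k; case: eqP => [<- //|/eqP nk].
by rewrite ltn_neqAle nk.
Qed.

Lemma closed_walk_prev (G : graph) (C : seq (gH G * gH G)) p :
  is_graph G -> closed_walk C -> p \in C -> exists2 q, q \in C & gmate G p.1 = q.2.
Proof.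
move=> [mateK _] CP pC; have ltp : (index p C < size C)%N by rewrite index_mem.
have C0 : (0 < size C)%N by apply: leq_ltn_trans ltp.
case Ek: (index p C) => [|k].
  exists (nth p C (size C).-1); first by rewrite mem_nth ?prednK.
  apply: (canLR mateK); rewrite closed_walk_next ?prednK // eqxx -Ek.
  by rewrite nth_index.
exists (nth p C k); first by rewrite mem_nth // ltnW // -Ek.
apply: (canLR mateK); rewrite closed_walk_next //; last by rewrite ltnW // -Ek.
by rewrite -Ek (ltn_eqF ltp) nth_index.
Qed.

Lemma circuit_mate_closed (G : graph) (C : seq (gH G * gH G)) h :
  is_graph G -> closed_walk C -> h \in halfedges C -> gmate G h \in halfedges C.
Proof.
move=> GP CP /mem_halfedges[p pC]; rewrite !inE => /orP[]/eqP->.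
  have [q qC ->] := closed_walk_prev GP CP pC.
  by apply/mem_halfedges; exists q; rewrite ?inE ?eqxx ?orbT.
have [q qC ->] := closed_walk_next_mem CP pC.
by apply/mem_halfedges; exists q; rewrite ?inE ?eqxx.
Qed.

Section Touch.
Variables (F : graph) (P : seq (seq (gH F * gH F))).
Hypotheses (FP : is_graph F) (F4 : four_regular F) (PP : circuit_partition P).

(** The transitions of all circuits pooled: each half-edge lies in exactly one pair of [Q]. *)
Let Q := flatten P.

Let uniqQ : uniq (halfedges Q).
Proof.
case: PP => _ c1; rewrite /Q.
rewrite halfedges_flatten.
by apply: count_mem_uniq => h; rewrite -has_pred1 has_count c1.
Qed.

Let Qcover h : exists2 p, p \in Q & h \in [set p.1; p.2].
Proof.
apply/mem_halfedges; rewrite -has_pred1 has_count.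
by case: PP => _ /(_ h) c1; rewrite halfedges_flatten c1.
Qed.

Let Qdst p : p \in Q -> (p.1 != p.2) && (gend F p.1 == gend F p.2).
Proof.
case/flattenP=> C CP pC; case: PP => /allP/(_ C CP)/and3P[/andP[/allP Cd _] _ _] _.
exact: Cd.
Qed.

Let STPP s : reflect (exists2 p, p \in Q & s = [set p.1; p.2]) (s \in STP P).
Proof.
rewrite inE; apply: (iffP hasP) => [[C CP /imsetP[p pC ->]]|[p /flattenP[C CP pC] ->]].
  by exists p => //; apply/flattenP; exists C.
by exists C => //; apply/imsetP; exists p.
Qed.

Let st_ofP h : st_of P h \in STP P /\ h \in st_of P h.
Proof.
rewrite /st_of; case: pickP => [s /andP[]//|/=].
have [p pQ hp] := Qcover h; move=> /(_ [set p.1; p.2]).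
by rewrite hp andbT => /STPP[]; exists p.
Qed.

Definition single_transition h : tch_H P := exist _ (st_of P h) (st_ofP h).1.
Local Notation st := single_transition.

Lemma mem_tch (s : tch_H P) h : (h \in val s) = (s == st h).
Proof.
apply/idP/eqP=> [hs|->]; last by case: (st_ofP h).
apply: val_inj; have [/STPP[q qQ Eq] hq] := st_ofP h.
have /STPP[p pQ Ep] := valP s; rewrite /= Eq Ep; rewrite Ep in hs; rewrite Eq in hq.
by rewrite (uniq_halfedges_pair uniqQ pQ qQ hs hq).
Qed.

Lemma tch_pair (s : tch_H P) :
  exists p, [/\ p \in Q, val s = [set p.1; p.2], s = st p.1 & s = st p.2].
Proof.
have /STPP[p pQ Ep] := valP s; exists p.
by split=> //; apply/eqP; rewrite -mem_tch Ep !inE eqxx ?orbT.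
Qed.

Lemma card_tch (s : tch_H P) : #|val s| = 2%N.
Proof. by have [p [/Qdst/andP[pN _] -> _ _]] := tch_pair s; rewrite cards2 pN. Qed.

Lemma st_pair p : p \in Q -> st p.1 = st p.2 /\ val (st p.1) = [set p.1; p.2].
Proof.
move=> pQ; have sP : [set p.1; p.2] \in STP P by apply/STPP; exists p.
have E (h : gH F) : h \in [set p.1; p.2] -> exist (fun s => s \in STP P) _ sP = st h.
  by move=> hp; apply/eqP; rewrite -mem_tch.
by rewrite -!E ?inE ?eqxx ?orbT.
Qed.

Lemma st_gend h k : st h = st k -> gend F h = gend F k.
Proof.
move=> E; have [p [/Qdst/andP[_ /eqP pe] Ep _ _]] := tch_pair (st h).
have : h \in val (st h) by rewrite mem_tch.
have : k \in val (st h) by rewrite mem_tch E.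
by rewrite Ep !inE => /orP[]/eqP-> /orP[]/eqP->.
Qed.

(** Two distinct single transitions at a vertex are disjoint with two half-edges each. As the vertex
    has four half-edges, each is the complement of the other, so [insubd] does not fall back on its
    default. *)
Lemma tch_mate_st h k : gend F h = gend F k -> st h != st k -> tch_mate (st h) = st k.
Proof.
move=> Ehk Nhk; rewrite /tch_mate.
have Eh : gend F @: val (st h) = [set gend F h].
  apply/setP=> v; rewrite inE; apply/imsetP/eqP=> [[l]|->].
    by rewrite mem_tch => /eqP/st_gend<-.
  by exists h; rewrite ?mem_tch.
suff -> : [set l | gend F l \in gend F @: val (st h)] :\: val (st h) = val (st k).
  by rewrite /insubd valK.
apply/esym/eqP; rewrite eqEcard card_tch cardsD; apply/andP; split.
  apply/subsetP=> l; rewrite !inE Eh inE !mem_tch => /eqP E.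
  by rewrite -E Nhk Ehk -(st_gend E) eqxx.
rewrite (setIidPr _) ?card_tch.
  rewrite leq_subLR -[X in (_ <= X)%N]/4%N -(F4 (gend F h)) Eh.
  by apply/subset_leq_card/subsetP=> l; rewrite !inE.
apply/subsetP=> l; rewrite Eh !inE mem_tch => /eqP E.
by rewrite (st_gend E).
Qed.

(** Any half-edge at the vertex of [s] that lies outside [s] represents the mate. *)
Lemma tch_vertex (s : tch_H P) :
  exists h k, [/\ s = st h, tch_mate s = st k, gend F h = gend F k & st h != st k].
Proof.
have [p [_ _ Es _]] := tch_pair s.
have [k] : exists k, k \in [set h | gend F h == gend F p.1] :\: val s.
  apply/set0Pn; rewrite -card_gt0 cardsD subn_gt0 F4.
  by apply: leq_ltn_trans (subset_leq_card (subsetIr _ _)) _; rewrite card_tch.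
rewrite !inE mem_tch => /andP[Nk /eqP Ek]; exists p.1, k.
by split; rewrite -?Es // [in LHS]Es (@tch_mate_st _ k) -?Es.
Qed.

Lemma Tch_is_graph : is_graph (Tch P).
Proof.
split=> s; have [h [k [-> Ek E N]]] := tch_vertex s.
  by rewrite /= (tch_mate_st E N); apply: tch_mate_st; rewrite // eq_sym.
by rewrite /= (tch_mate_st E N) eq_sym.
Qed.

Lemma tch_end_pair (s : tch_H P) :
  exists2 p, p \in nth [::] P (tch_end s) & val s = [set p.1; p.2].
Proof.
have : has (fun C => val s \in st_set C) P by have := valP s; rewrite inE.
by move/(nth_find [::])/imsetP.
Qed.

Let nthQ i p : (i < size P)%N -> p \in nth [::] P i -> p \in Q.
Proof. by move=> lti pi; apply/flattenP; exists (nth [::] P i); rewrite ?mem_nth. Qed.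

(** [tch_end] takes the first circuit containing the transition; it is the only one, as no half-edge
    lies in two circuits. *)
Lemma tch_end_st (i : 'I_(size P)) h :
  (tch_end (st h) == i) = (h \in halfedges (nth [::] P i)).
Proof.
apply/eqP/mem_halfedges=> [<-|[p pi hp]].
  have [p pC Ep] := tch_end_pair (st h).
  by exists p => //; rewrite -Ep mem_tch.
have [q qC Eq] := tch_end_pair (st h).
have hq : h \in [set q.1; q.2] by rewrite -Eq mem_tch.
have E : p = q.
  exact: uniq_halfedges_pair uniqQ (nthQ (ltn_ord i) pi) (nthQ (ltn_ord _) qC) hp hq.
by apply/val_inj/(uniq_flatten_nth (uniq_halfedges uniqQ) qC); rewrite -E.
Qed.

Lemma tch_end_mate h : tch_end (st (gmate F h)) = tch_end (st h).
Proof.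
apply/eqP; rewrite tch_end_st circuit_mate_closed //; last by rewrite -tch_end_st.
case: PP => /allP/(_ (nth [::] P (tch_end (st h)))) + _.
by rewrite mem_nth ?ltn_ord // => /(_ isT)/and3P[].
Qed.

Lemma pi_pairE p :
  pi_pair P p = if st p.1 != st p.2 then Some (st p.1, st p.2) else None.
Proof.
have E h : insub (st_of P h) = Some (st h) := valK (st h).
by rewrite /pi_pair !E.
Qed.

(** A kept pair [(a, b)] has [b] the mate of [a], so it counts 1 at [a] and -1 at [b]. A deleted
    pair has both half-edges in one transition, where the two terms cancel. *)
Lemma net_pi W (s : tch_H P) : all (@dst F) W ->
  net (G := Tch P) (pi_P P W) s
  = \sum_(p <- W) ((p.1 \in val s)%:Z - (p.2 \in val s)%:Z).
Proof.
elim: W => [|p W IHW] /=; first by rewrite big_nil.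
case/andP=> /andP[_ /eqP Ep] /IHW; rewrite big_cons /net /pi_P /= pi_pairE => <-.
have [mateK mateN] := Tch_is_graph; rewrite !mem_tch.
have [->|Np] /= := eqVneq (st p.1) (st p.2); first by lia.
have Em := tch_mate_st Ep Np.
rewrite !xpair_eqE -Em [tch_mate _ == tch_mate _](inj_eq (inv_inj mateK)) andbb.
rewrite [_ == tch_mate s]eq_sym (can2_eq mateK mateK) [_ == s]eq_sym.
by rewrite /= [tch_mate (st p.1) == s]eq_sym andbb; lia.
Qed.

(** Up to shift and reversal, each pair of [W] is a single transition of [P], so [pi_P] deletes
    it. *)
Lemma pi_P_circuit W C : C \in P -> same_circuit W C -> pi_P P W = [::].
Proof.
move=> CP /hasP[k _ WC].
have stW p : p \in W -> st p.1 = st p.2.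
  case/orP: WC => /eqP->; rewrite mem_rot ?mem_rev => pC.
    by have [] // := @st_pair p _; apply/flattenP; exists C.
  case/mapP: pC => q qC -> /=.
  by have [] // := @st_pair q _; apply/flattenP; exists C.
rewrite /pi_P; elim: W stW {WC} => //= p W IHW stW.
rewrite pi_pairE stW ?mem_head // eqxx /=; apply: IHW => q qW.
by apply: stW; rewrite inE qW orbT.
Qed.

End Touch.

(** * Lifting flows from the touch-graph *)

(** [gmate] permutes the index set, so the sum equals its own negative. *)
Lemma sum_alternating_closed (G : graph) (a : pred (gH G)) (g : gH G -> int) :
  is_graph G -> (forall h, a (gmate G h) = a h) -> alternating g ->
  \sum_(h | a h) g h = 0.
Proof.
move=> [mateK _] aM gA; suff : \sum_(h | a h) g h = - \sum_(h | a h) g h by lia.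
rewrite -sumrN {1}(reindex_inj (inv_inj mateK)) /=.
by rewrite (eq_bigl _ _ aM); apply: eq_bigr => h _; rewrite gA.
Qed.

(** The edges of [p.1] and [q.1] lie in [X] and are traversed by [C], so they coincide; it remains
    to exclude that [p.1] is the mate of [q.1]. *)
Lemma circuit_unique_cut (G : graph) (C : seq (gH G * gH G)) (X : {set gH G}) p q :
  is_graph G -> circuit C -> edge_set X -> (traversed_in C X <= 1)%N ->
  p \in C -> q \in C -> p.1 \in X -> q.1 \in X -> p = q.
Proof.
move=> GP /and3P[CP _ uC] XP CX pC qC pX qX; have [mateK _] := GP.
have edge r : r \in C -> r.1 \in X ->
    edge_of r.1 \in [set e in [set [set t.1; t.2] | t in traversals C] | e \subset X].
  move=> rC rX; rewrite inE; apply/andP; split; last first.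
    by apply/subsetP=> h; rewrite !inE => /orP[]/eqP->; rewrite ?XP.
  have [/andP[_ /allP CT] sz] : closed_walk C /\
      size (map snd C) = size (rot 1 (map fst C)) by rewrite size_rot !size_map.
  have : r.1 \in rot 1 (map fst C) by rewrite mem_rot map_f.
  rewrite -[rot 1 _](@unzip2_zip _ _ (map snd C)) ?sz // => /mapP[[a b] abC /= rb].
  apply/imsetP; exists (a, b) => //=; have /eqP/= := CT _ abC.
  by rewrite /edge_of rb setUC => <-; rewrite mateK.
have /cards1P[e Ee] : traversed_in C X == 1%N.
  by rewrite eqn_leq CX card_gt0; apply/set0Pn; exists (edge_of p.1); apply: edge.
have := edge _ pC pX; have := edge _ qC qX; rewrite Ee !inE => /eqP<- /eqP/setP.
move=> /(_ p.1); rewrite !inE eqxx /= => /esym/orP[]/eqP pq.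
  apply: (uniq_halfedges_pair uC pC qC (h := p.1)); first by rewrite !inE eqxx.
  by rewrite pq !inE eqxx.
(* Otherwise the transition before [q] ends with [p.1], hence is [p] itself, whose two half-edges
   would be equal. *)
have [r rC Er] := closed_walk_prev GP CP qC; rewrite -pq in Er.
have Epr : p = r.
  by apply: (uniq_halfedges_pair uC pC rC (h := p.1)); rewrite !inE ?Er eqxx ?orbT.
have /andP[/allP/(_ _ rC)/andP[]] := CP.
by rewrite -{1}Epr Er eqxx.
Qed.

(* The prefix sums of [w] along [C], shifted so as to vanish where [C] meets [X]. *)
Lemma circuit_potential (R : comNzRingType) (G : graph) (C : seq (gH G * gH G))
    (X : {set gH G}) (w : gH G * gH G -> R) :
  is_graph G -> circuit C -> edge_set X -> (traversed_in C X <= 1)%N ->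
  \sum_(p <- C) w p = 0 ->
  exists g : gH G -> R,
    [/\ forall p, p \in C -> g p.1 + g p.2 = - w p,
        forall h, h \in halfedges C -> g (gmate G h) = - g h &
        forall h, h \in halfedges C -> h \in X -> g h = 0].
Proof.
move=> GP CC XP CX w0; have /and3P[CP C0 uC] := CC; have [mateK _] := GP.
have [/allP Cdst _] := andP CP.
pose A k := \sum_(p <- take k C) w p.
(* The only transition that can start in [X]. If there is none, [K] is [size C] and [A K] is the
   total, 0. *)
pose K := find (fun p => p.1 \in X) C.
pose pos h := find (fun p => h \in [set p.1; p.2]) C.
pose g h := if (nth (h, h) C (pos h)).1 == h then A (pos h) - A K
            else A K - A (pos h).+1.
have posP h p : p \in C -> h \in [set p.1; p.2] -> pos h = index p C.
  move=> pC hp; have hC : has (fun p => h \in [set p.1; p.2]) C.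
    by apply/hasP; exists p.
  rewrite -(@uniq_halfedges_pair _ _ h (nth p C (pos h)) p uC) //.
  - by rewrite index_uniq -?has_find ?uniq_halfedges.
  - by rewrite mem_nth -?has_find.
  - exact: (nth_find p hC).
have g1 p : p \in C -> g p.1 = A (index p C) - A K.
  move=> pC; rewrite /g (posP _ p) // ?inE ?eqxx //.
  by rewrite (set_nth_default p) ?index_mem // nth_index // eqxx.
have g2 p : p \in C -> g p.2 = A K - A (index p C).+1.
  move=> pC; rewrite /g (posP _ p) // ?inE ?eqxx ?orbT //.
  rewrite (set_nth_default p) ?index_mem // nth_index //.
  by have /andP[/negPf->] := Cdst p pC.
have AS p : p \in C -> A (index p C).+1 = A (index p C) + w p.
  move=> pC; rewrite /A (take_nth p) ?index_mem // nth_index //.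
  by rewrite -cats1 big_cat big_seq1.
have gm2 p : p \in C -> g (gmate G p.2) = - g p.2.
  move=> pC; rewrite g2 // opprB.
  have ltp : (index p C < size C)%N by rewrite index_mem.
  have := closed_walk_next p CP ltp; rewrite nth_index // => ->.
  set k := (if _ then _ else _).
  have ltk : (k < size C)%N.
    by rewrite /k; case: eqP => [<- //|/eqP nk]; rewrite ltn_neqAle nk.
  rewrite g1 ?mem_nth // index_uniq ?uniq_halfedges //.
  (* After the last transition the prefix sum is back at 0, because [w] sums to zero around [C]. *)
  congr (_ - _); rewrite /k; case: eqP => // ->.
  by rewrite /A take0 big_nil take_size w0.
have gm1 p : p \in C -> g (gmate G p.1) = - g p.1.
  move=> pC; have [q qC Eq] := closed_walk_prev GP CP pC.
  by rewrite -{2}[p.1]mateK Eq gm2 // opprK.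
exists g; split.
- move=> p pC; rewrite g1 // g2 // AS //; ring.
- by move=> h /mem_halfedges[p pC]; rewrite !inE => /orP[]/eqP->; auto.
have gX p : p \in C -> p.1 \in X -> g p.1 = 0.
  move=> pC pX; rewrite g1 //; have CXp : has (fun p => p.1 \in X) C.
    by apply/hasP; exists p.
  rewrite -(@circuit_unique_cut _ C X (nth p C K) p) // ?mem_nth -?has_find //.
    by rewrite index_uniq ?subrr -?has_find ?uniq_halfedges.
  exact: (nth_find p CXp).
move=> h /mem_halfedges[p pC]; rewrite !inE => /orP[]/eqP-> pX; first exact: gX.
(* If [p.2] is in [X], so is its mate, the start of the next transition. *)
have [q qC Eq] := closed_walk_next_mem CP pC.
by apply: oppr_inj; rewrite oppr0 -gm2 // Eq gX // -Eq XP.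
Qed.

Lemma sum_delete_edges (R : comNzRingType) (G : graph) (X : {set gH G})
    (a : pred (gH G)) (g : gH G -> R) :
  (forall h, h \in X -> g h = 0) ->
  \sum_(h : gH (delete_edges G X) | a (val h)) g (val h) = \sum_(h | a h) g h.
Proof.
move=> gX; rewrite -(big_sub_cond (fun h => h \notin X)) /=.
rewrite [RHS](bigID [pred h | h \in X]) /= [X in X + _]big1 ?add0r.
  by apply: eq_bigl => h; rewrite andbC.
by move=> h /andP[_ /gX].
Qed.

(** * The map induced by [pi_P] on the flows of F - E *)

Section DeleteEdges.
Variables (F : graph) (P : seq (seq (gH F * gH F))) (X : {set gH F}).
Hypotheses (FP : is_graph F) (F4 : four_regular F) (PP : circuit_partition P).
Hypotheses (XP : edge_set X) (PX : forall C, C \in P -> (traversed_in C X <= 1)%N).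
Let G := delete_edges F X.
Local Notation st := (single_transition PP).

Let val_mate (h : gH G) : val (gmate G h) = gmate F (val h).
Proof. by rewrite /= val_insubd XP (valP h). Qed.

Lemma delete_edges_is_graph : is_graph G.
Proof.
have [mateK mateN] := FP; split=> h; last by rewrite -val_eqE val_mate mateN.
by apply: val_inj; rewrite !val_mate mateK.
Qed.

(** In the image a first component counts positively, whereas in [net] it is where a traversal ends;
    hence the minus sign. *)
Lemma net_pi_lift (W : seq (gH G * gH G)) (s : tch_H P) : closed_walk W ->
  net (G := Tch P) (pi_P P (lift_walk W)) s
  = - \sum_(h : gH G | val h \in val s) net (traversals W) h.
Proof.
move=> WP; rewrite (net_pi F4 PP); last first.
  have /andP[/allP Wd _] := WP; apply/allP=> _ /mapP[p /Wd pd ->].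
  by rewrite /dst /= (inj_eq val_inj).
rewrite /lift_walk big_map /=.
under [in RHS]eq_bigr => h _ do
  rewrite (net_closed_walk delete_edges_is_graph) //.
rewrite !sumrB !(sum_count_mem_int [pred h : gH G | val h \in val s]) opprB.
rewrite !count_map; congr (_ - _); elim: (W) => [|p V IHV];
  by rewrite ?big_nil // big_cons IHV.
Qed.

(** The sum at a vertex of Tch(P) is, up to sign, the sum of an alternating function over the
    remaining half-edges of a circuit, a set closed under mates. *)
Lemma net_pi_flow (W : seq (gH G * gH G)) : closed_walk W ->
  flow (G := Tch P) (net (pi_P P (lift_walk W))).
Proof.
move=> WP; split; first exact/net_alternating/(Tch_is_graph F4 PP).
move=> i; under eq_bigr => s _ do rewrite (net_pi_lift s WP).
have GP := delete_edges_is_graph.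
rewrite sumrN -[RHS]oppr0; congr (- _).
rewrite -[RHS](@sum_alternating_closed G (fun h => tch_end (st (val h)) == i)
  (net (traversals W)) GP); last 2 first.
- by move=> h; rewrite val_mate tch_end_mate.
- exact: net_alternating.
rewrite [RHS](partition_big (fun h => st (val h)) (fun s => tch_end s == i)) //=.
apply: eq_bigr => s si; apply: eq_bigl => h; rewrite mem_tch eq_sym.
by rewrite andb_idl // => /eqP->.
Qed.

(** [p] to [st p.1] is a bijection from the pairs of a circuit to the half-edges of Tch(P) at it. *)
Lemma sum_tch_end (R : comNzRingType) (y : tch_H P -> R) (i : 'I_(size P)) :
  \sum_(p <- nth [::] P i) y (st p.1) = \sum_(s | tch_end s == i) y s.
Proof.
have Ci : nth [::] P i \in P by rewrite mem_nth.
have pQ p : p \in nth [::] P i -> p \in flatten P.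
  by move=> pC; apply/flattenP; exists (nth [::] P i).
rewrite -(big_map (fun p => st p.1) xpredT y) /= big_uniq /=.
  apply: eq_bigl => s; apply/mapP/eqP=> [[p pC ->]|<-].
    apply/eqP; rewrite tch_end_st; apply/mem_halfedges; exists p => //.
    by rewrite !inE eqxx.
  have [p pC Ep] := tch_end_pair s; exists p => //.
  by apply/eqP; rewrite -mem_tch Ep !inE eqxx.
have /and3P[_ _ uC] : circuit (nth [::] P i) by case: PP => /allP/(_ _ Ci).
rewrite map_inj_in_uniq ?uniq_halfedges // => p q pC qC Epq.
apply: (uniq_halfedges_pair uC pC qC (h := p.1)); first by rewrite !inE eqxx.
by have [_ <-] := st_pair PP (pQ q qC); rewrite mem_tch Epq.
Qed.

(** [circuit_potential] applies to each circuit of [P], since the total of [y] around it is the sum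
    of [y] at a vertex of Tch(P). The potentials vanish on [X], so restricting them to F - E changes
    no sum. *)
Lemma flow_lift (R : comNzRingType) (y : tch_H P -> R) :
  flow (G := Tch P) y ->
  exists2 g : gH G -> R, flow g &
    forall s, y s = - \sum_(h : gH G | val h \in val s) g h.
Proof.
move=> [yA y0].
have /fin_all_exists[f fP] (i : 'I_(size P)) : exists g : gH F -> R,
    [/\ forall p, p \in nth [::] P i -> g p.1 + g p.2 = - y (st p.1),
        forall h, h \in halfedges (nth [::] P i) -> g (gmate F h) = - g h &
        forall h, h \in halfedges (nth [::] P i) -> h \in X -> g h = 0].
  have Ci : nth [::] P i \in P by rewrite mem_nth.
  apply: (circuit_potential (w := fun p => y (st p.1))) => //; last 2 first.
  - exact: PX.
  - by rewrite sum_tch_end; apply: y0.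
  by case: PP => /allP/(_ _ Ci).
(* Each half-edge takes its value from the potential of its own circuit. *)
pose g h := f (tch_end (st h)) h.
have gX h : h \in X -> g h = 0.
  by move=> hX; rewrite /g; have [_ _ ->] := fP (tch_end (st h)); rewrite -?(tch_end_st PP).
have gA : alternating g.
  move=> h; rewrite /g tch_end_mate //.
  by have [_ ->] := fP (tch_end (st h)); rewrite -?(tch_end_st PP).
have gS (s : tch_H P) : \sum_(h in val s) g h = - y s.
  have [p pC Ep] := tch_end_pair s; have [fs _ _] := fP (tch_end s).
  have Es h : h \in val s -> s = st h by rewrite (mem_tch PP) => /eqP.
  have [E1 E2] : s = st p.1 /\ s = st p.2 by split; apply: Es; rewrite Ep !inE eqxx ?orbT.
  have /eqP := card_tch PP s; rewrite Ep cards2 eqSS eqb1 => Np.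
  rewrite big_setU1 ?inE //= big_set1 /g -E1 -E2 fs //; congr (- y _).
  by rewrite -E1.
have sum_g (a : pred (gH F)) :
    \sum_(h : gH G | a (val h)) g (val h) = \sum_(h | a h) g h.
  exact: sum_delete_edges.
exists (fun h => g (val h)) => [|s]; last first.
  by rewrite (sum_g (fun h => h \in val s)) gS opprK.
split=> [h|v]; first by rewrite val_mate gA.
rewrite (sum_g (fun h => gend F h == v)).
have /card_gt0P[h] : (0 < #|[set h | gend F h == v]|)%N by rewrite F4.
rewrite inE => /eqP hv.
(* The half-edges at [v] form the transition of [h] and its mate, on which [g] has opposite sums
   because [y] is alternating. *)
rewrite (bigID (fun k => st h == st k)) /=.
have [_ mateN] := Tch_is_graph F4 PP.
rewrite (eq_bigl (fun k => k \in val (st h))) => [|k]; last first.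
  by rewrite (mem_tch PP) andb_idl // -hv => /eqP/st_gend->.
rewrite [X in _ + X](eq_bigl (fun k => k \in val (tch_mate (st h)))) => [|k].
  by rewrite !gS (yA (st h)) subrr.
rewrite (mem_tch PP); apply/andP/eqP=> [[/eqP kv hk]|Ek].
  by apply: tch_mate_st; rewrite ?kv.
have [h1 [k1 [Eh1 Ek1 Ehk _]]] := tch_vertex F4 PP (st h).
split; last by rewrite -Ek eq_sym; apply: mateN.
by rewrite -hv (st_gend Eh1) Ehk -(st_gend (etrans (esym Ek) Ek1)).
Qed.

Section Span.
Variable Gam : seq (seq (gH G * gH G)).
Hypothesis GamP : all (@closed_walk G) Gam.
Let piGam := map (pi_P P) (minus_P P (map (@lift_walk F X) Gam)).

Lemma piGam_flow T : T \in piGam -> flow (G := Tch P) (net T).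
Proof.
case/mapP=> W; rewrite mem_filter => /andP[_ /mapP[V VG ->]] ->.
by apply: net_pi_flow; apply: (allP GamP).
Qed.

(** Lift [y] to F - E, expand the lift in [Gam], and apply the linear map to the expansion. Any ring
    is allowed, to serve both rational and integral spans. *)
Lemma spanned_piGam (R : comNzRingType) :
  (forall g : gH G -> R, flow g -> spanned (map (@traversals G) Gam) g) ->
  forall y : tch_H P -> R, flow (G := Tch P) y -> spanned (G := Tch P) piGam y.
Proof.
move=> sp y /flow_lift[g /sp[]]; rewrite size_map => c Ec Ey.
apply: (@spanned_sum _ _ _ _ (index_enum 'I_(size Gam)) c (fun i s =>
   (net (G := Tch P) (pi_P P (lift_walk (nth [::] Gam i))) s)%:~R)) => [s|i].
  rewrite Ey; under eq_bigr => h _ do rewrite Ec.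
  rewrite exchange_big -sumrN /=; apply: eq_bigr => i _.
  rewrite -mulr_sumr -mulrN; congr (_ * _).
  rewrite net_pi_lift ?(allP GamP) ?mem_nth // mulrNz rmorph_sum /=; congr (- _).
  by apply: eq_bigr => h _; rewrite (nth_map [::]).
have WG : nth [::] Gam i \in Gam by apply: mem_nth.
(* A walk removed by [minus_P] has an empty image, so its term is zero. *)
have [/hasP[C CP WC]|WP] :=
    boolP (has (fun C => same_circuit (lift_walk (nth [::] Gam i)) C) P).
  rewrite (pi_P_circuit PP CP WC); exists (fun=> 0) => s.
  by rewrite /net /= big1 // => j _; rewrite mul0r.
by apply/spanned_net/map_f; rewrite mem_filter WP map_f.
Qed.

End Span.
End DeleteEdges.

Theorem mainTheorem7 (F : graph) (P : seq (seq (gH F * gH F))) (X : {set gH F})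
  (Gam : seq (seq (gH (delete_edges F X) * gH (delete_edges F X)))) :
  is_graph F -> four_regular F -> circuit_partition P -> edge_set X ->
  (forall C, C \in P -> (traversed_in C X <= 1)%N) ->
  cycle_spanning_set Gam ->
  let piGam := map (pi_P P) (minus_P P (map (@lift_walk F X) Gam)) in
  tr_spanning piGam /\
  (integral_cycle_spanning_set Gam -> tr_spanning piGam /\ tr_integral piGam).
Proof.
move=> FP F4 PP XP PX [GamP GamS] piGam.
have GP := delete_edges_is_graph FP XP; have TP := Tch_is_graph F4 PP.
have piS : tr_spanning (G := Tch P) piGam.
  apply: flow_tr_spanning => // [T|y]; first exact: piGam_flow.
  by apply: spanned_piGam => // g; apply: tr_spanning_flow.
split=> // -[_ GamI]; split=> //.
(* The same transfer over the integers, where integrality of [Gam] spans all integral flows of F -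
   E. *)
apply: flow_tr_integral => // y; apply: spanned_piGam => // g.
exact: int_flow_spanned.
Qed.
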